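(* Let $\Gamma$ be an infinite discrete group and let $\beta\Gamma$ be its Čech–Stone compactification, with its right topological semigroup structure. For each element $p \in \beta\Gamma\setminus\Gamma$, the left multiplication map $L_p:\beta\Gamma\to\beta\Gamma$, $L_p(q)=pq$, is not Borel measurable.
   Context: Elements of $\beta\Gamma$ are identified with ultrafilters on the set $\Gamma$, and $\Gamma\subset\beta\Gamma$ is identified with the set of principal ultrafilters. The semigroup product on $\beta\Gamma$ is defined by $$A\in pq \iff \{\gamma\in\Gamma : \gamma^{-1}A\in q\}\in p \qquad (A\subset\Gamma).$$ With this product every right multiplication $R_p: q\mapsto qp$ is continuous. The Borel $\sigma$-algebra of the compact Hausdorff space $\beta\Gamma$ is the smallest $\sigma$-algebra containing the open sets. A map $\beta\Gamma\to\beta\Gamma$ is Borel measurable if the preimage of every Borel set is a Borel set. *)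

(* Defs.v *)
From HB Require Import structures.
From mathcomp Require Import all_boot all_classical all_analysis.

Set Implicit Arguments.
Unset Strict Implicit.
Unset Printing Implicit Defensive.

Local Open Scope classical_set_scope.
Local Open Scope group_scope.

(* The points of the Cech-Stone compactification of the discrete space T are
   the ultrafilters on T; beta_principal below embeds T in it. *)
Record beta (T : Type) := Beta {
  beta_sets :> set T -> Prop;
  beta_ultra : UltraFilter beta_sets }.

Arguments Beta {T}.

#[export] Existing Instance beta_ultra.

HB.instance Definition _ (T : Type) := gen_eqMixin (beta T).
HB.instance Definition _ (T : Type) := gen_choiceMixin (beta T).

Lemma beta_inj (T : Type) (p q : beta T) : (p : set_system T) = q -> p = q.
Proof.
case: p q => [p hp] [q hq] /= epq; case: _ / epq in hq *.
by congr Beta; exact: Prop_irrelevance.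
Qed.

Lemma beta_ext (T : Type) (p q : beta T) : (forall A, p A -> q A) -> p = q.
Proof.
by move=> pq; apply: beta_inj; symmetry; apply: max_filter => A; exact: pq.
Qed.

Lemma betaC (T : Type) (p : beta T) (A : set T) : p (~` A) <-> ~ p A.
Proof.
split=> [pcA pA|npA]; last by have [] := in_ultra_setVsetC A (beta_ultra p).
by have [x []] := filter_ex (filterI pA pcA).
Qed.

Lemma ultra_of_setVsetC (T : Type) (F : set_system T) :
  ProperFilter F -> (forall A, F A \/ F (~` A)) -> UltraFilter F.
Proof.
move=> FF FVC; split=> // G GG FG; apply/seteqP; split=> // A GA.
have [//|/FG GcA] := FVC A.
by have [x []] := filter_ex (filterI GA GcA).
Qed.

Definition beta_principal (T : Type) (x : T) : beta T :=
  Beta (principal_filter x) (principal_filter_ultra x).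

(* The Stone topology: the sets {p | A \in p} form a base of open sets. *)
Section stone_topology.
Variable T : Type.

Let base (A : set T) : set (beta T) := [set p | p A].

Let base_cover : \bigcup_(A in setT) base A = setT.
Proof. by apply/seteqP; split=> // p _; exists setT => //; exact: filterT. Qed.

Let base_join (A B : set T) (p : beta T) : setT A -> setT B ->
  base A p -> base B p ->
  exists C, [/\ setT C, base C p & base C `<=` base A `&` base B].
Proof.
move=> _ _ pA pB; exists (A `&` B); split=> //; first exact: filterI.
move=> q qAB; change (q (A `&` B)) in qAB; change (q A /\ q B).
split; first by apply: filterS qAB; exact: subIsetl.
by apply: filterS qAB; exact: subIsetr.
Qed.

HB.instance Definition _ :=
  isBaseTopological.Build (beta T) base_cover base_join.

Lemma open_beta_base (A : set T) : open [set p : beta T | p A].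
Proof. by exists [set A] => //; rewrite bigcup_set1. Qed.

Lemma nbhs_betaP (p : beta T) (V : set (beta T)) :
  nbhs p V <-> exists2 A, p A & [set q : beta T | q A] `<=` V.
Proof.
split=> [|[A pA AV]]; last first.
  by apply: (filterS AV); apply: open_nbhs_nbhs; split=> //; exact: open_beta_base.
rewrite nbhsE => -[U [[D _ <-] [A DA pA]] UV].
by exists A => // q qA; apply: UV; exists A.
Qed.

Lemma beta_hausdorff : hausdorff_space (beta T).
Proof.
move=> p q pq; apply: beta_ext => A pA; apply: contrapT => /betaC qcA.
have pA' : nbhs p [set r : beta T | r A] by apply/nbhs_betaP; exists A.
have qA' : nbhs q [set r : beta T | r (~` A)].
  by apply/nbhs_betaP; exists (~` A).
by have [r [rA /betaC]] := pq _ _ pA' qA'.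
Qed.

Lemma beta_compact : compact [set: beta T].
Proof.
rewrite compact_ultra => F FU _.
pose L : set_system T := [set A | F [set p : beta T | p A]].
have LF : ProperFilter L.
  apply: Build_ProperFilter_ex.
    move=> A LA; have [p pA] := @filter_ex _ F _ _ LA.
    exact: (filter_ex pA).
  split.
  - by apply: (@filterS _ F _ _ _ _ filterT) => p _; exact: filterT.
  - move=> A B LA LB; apply: (@filterS2 _ F _ _ _ _ _ LA LB) => p.
    exact: filterI.
  - by move=> A B AB; apply: (@filterS _ F) => p; exact: filterS.
have LU : UltraFilter L.
  apply: ultra_of_setVsetC => A.
  have [?|FcA] := in_ultra_setVsetC [set p : beta T | p A] FU; [by left|right].
  by apply: (@filterS _ F _ _ _ _ FcA) => p /betaC.
exists (Beta L LU); split=> // V /nbhs_betaP[A LA AV].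
exact: (@filterS _ F _ _ _ AV LA).
Qed.

End stone_topology.

Section beta_group.
Variable G : groupType.

(* measurable types are required to be pointed; the base point is irrelevant. *)
HB.instance Definition _ := isPointed.Build (beta G) (beta_principal (1 : G)).

(* the translate g A *)
Definition ltrans_set (g : G) (A : set G) : set G := [set g * a | a in A].

Lemma ltrans_setVE (g : G) (A : set G) :
  ltrans_set g^-1 A = [set x | A (g * x)].
Proof.
apply/seteqP; split=> [_ [a Aa <-]|x Agx] /=; first by rewrite mulVKg.
by exists (g * x) => //; rewrite mulKg.
Qed.

Definition beta_mul_sets (p q : beta G) : set_system G :=
  [set A | p [set g | q (ltrans_set g^-1 A)]].

Lemma beta_mul_setsE (p q : beta G) (A : set G) :
  beta_mul_sets p q A = p [set g | q [set x | A (g * x)]].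
Proof.
by congr (beta_sets p _); apply/seteqP; split=> g /=; rewrite ltrans_setVE.
Qed.

Lemma beta_mul_ultra (p q : beta G) : UltraFilter (beta_mul_sets p q).
Proof.
have pqF : ProperFilter (beta_mul_sets p q).
  apply: Build_ProperFilter_ex.
    move=> A; rewrite beta_mul_setsE => pA.
    have [g qA] := filter_ex pA; have [x Agx] := @filter_ex _ q _ _ qA.
    by exists (g * x).
  split.
  - rewrite beta_mul_setsE; apply: (@filterS _ p _ _ _ _ filterT) => g _.
    exact: (@filterS _ q _ _ _ _ filterT).
  - move=> A B; rewrite !beta_mul_setsE => pA pB.
    by apply: (@filterS2 _ p _ _ _ _ _ pA pB) => g; exact: filterI.
  - move=> A B AB; rewrite !beta_mul_setsE; apply: filterS => g.
    by apply: (@filterS _ q) => x; exact: AB.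
apply: ultra_of_setVsetC => A; rewrite !beta_mul_setsE.
have [?|pc] := in_ultra_setVsetC [set g | q [set x | A (g * x)]] (beta_ultra p).
  by left.
by right; apply: (@filterS _ p _ _ _ _ pc) => g /betaC.
Qed.

Definition beta_mul (p q : beta G) : beta G :=
  Beta (beta_mul_sets p q) (beta_mul_ultra p q).

Lemma beta_mulE (p q : beta G) (A : set G) :
  beta_mul p q A = p [set g | q [set x | A (g * x)]].
Proof. exact: beta_mul_setsE. Qed.

Lemma beta_mulA : associative beta_mul.
Proof.
move=> p q r; apply: beta_ext => A; rewrite !beta_mulE.
apply: (@filterS _ p) => g; rewrite {1}/mkset beta_mulE.
by apply: (@filterS _ q) => h; apply: (@filterS _ r) => x /=; rewrite mulgA.
Qed.

HB.instance Definition _ := hasMul.Build (beta G) beta_mul.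
HB.instance Definition _ := Magma_isSemigroup.Build (beta G) beta_mulA.

Lemma beta_principalM (g h : G) :
  beta_principal g * beta_principal h = beta_principal (g * h).
Proof.
apply: beta_ext => A.
have -> : (beta_principal g * beta_principal h) A
        = beta_principal g [set a | beta_principal h [set x | A (a * x)]].
  exact: beta_mulE.
by move=> /principal_filterP/principal_filterP Agh; exact/principal_filterP.
Qed.

Lemma beta_rmul_continuous (p : beta G) : continuous (fun q : beta G => q * p).
Proof.
move=> q V /nbhs_betaP[A qpA AV].
apply/nbhs_betaP; exists [set g | p (ltrans_set g^-1 A)] => // r rA.
exact: AV.
Qed.

End beta_group.

(* The same type, with the sigma-algebra generated by the open sets. *)
Definition borel (T : ptopologicalType) := g_sigma_algebraType (@open T).

HB.instance Definition _ (T : ptopologicalType) := Measurable.on (borel T).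

(* Main.v *)
Require Import Defs.
From mathcomp Require Import all_boot all_classical all_analysis.
From mathcomp Require wochoice.
From Stdlib Require Import Wellfounded.

Set Implicit Arguments.
Unset Strict Implicit.
Unset Printing Implicit Defensive.

Local Open Scope classical_set_scope.

(* Choose [A] in [G] whose translates are independent: every finite pattern of
   memberships [g x \in A] is realized by some [x].  The continuous map
   [f q = {g | g^-1 A \in q}] from [beta G] to the Cantor cube [2^G] is then
   onto, and the preimage of the clopen set [{r | A \in r}] under [L_p] is
   [f^-1 p], where [p] is seen as a subset of the cube.  On a minimal closed set
   mapped onto the cube, [f] is irreducible, so Borel sets correspond to sets
   with the Baire property.  Hence, if [L_p] were Borel, [p] would have the
   Baire property in the cube, which no nonprincipal ultrafilter has, because it
   is invariant under finite changes and exchanged with its complement by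
   complementation. *)

(** * Cardinal arithmetic of infinite sets *)

Lemma infinite_set_seq (T : Type) (A : set T) : infinite_set A ->
  exists2 f : nat -> T, injective f & forall n, A (f n).
Proof.
move=> /[dup]/infinite_setN0[t _] /infiniteP/card_leP[f].
exists (fun n => val (f (SigSub (mem_set (I : [set: nat] n)))))
  => [m n /val_inj|n].
  by move/(@inj _ _ _ f); rewrite !inE => /(_ I I)[].
exact/set_mem/valP.
Qed.

Lemma set_inj_total (T : Type) (A B : set T) :
  (exists2 f : T -> T, set_fun A B f & set_inj A f) \/
  (exists2 f : T -> T, set_fun B A f & set_inj B f).
Proof.
pose P : set (set (T * T)) := [set R | [/\ R `<=` A `*` B,
  forall x y y', R (x, y) -> R (x, y') -> y = y' &
  forall x x' y, R (x, y) -> R (x', y) -> x = x']].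
have [F FP Ftot|R [[RAB Rfun Rinj] Rmax]] := @Zorn_bigcup _ P.
  have common u v : (\bigcup_(X in F) X) u -> (\bigcup_(X in F) X) v ->
      exists2 X, F X & X u /\ X v.
    move=> [X FX Xu] [Y FY Yv]; have [XY|YX] := Ftot _ _ FX FY.
      by exists Y => //; split=> //; exact: XY.
    by exists X => //; split=> //; exact: YX.
  split=> [u [X /FP[XAB _ _] /XAB//]|x y y' u v|x x' y u v].
    by have [X /FP[_ Xf _] [Xu Xv]] := common _ _ u v; exact: Xf Xu Xv.
  by have [X /FP[_ _ Xi] [Xu Xv]] := common _ _ u v; exact: Xi Xu Xv.
have [Rdom|/existsNP[a /not_implyP[Aa Ra]]] :=
    pselect (forall x, A x -> exists y, R (x, y)).
  have /choice[f fR] x : exists y, A x -> R (x, y).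
    by have [/Rdom[y Ry]|nAx] := pselect (A x); [exists y|exists x].
  left; exists f => [x /fR/RAB[]//|x x' /set_mem/fR Rx /set_mem/fR Rx' e].
  by apply: Rinj Rx _; rewrite e.
have [Rran|/existsNP[b /not_implyP[Bb Rb]]] :=
    pselect (forall y, B y -> exists x, R (x, y)).
  have /choice[f fR] y : exists x, B y -> R (x, y).
    by have [/Rran[x Rx]|nBy] := pselect (B y); [exists x|exists y].
  right; exists f => [y /fR/RAB[]//|y y' /set_mem/fR Ry /set_mem/fR Ry' e].
  by apply: Rfun Ry _; rewrite e.
exfalso; apply: (Rmax (R `|` [set (a, b)])).
  split=> [u Ru|/(_ (a, b)) Rab]; first by left.
  by apply: Ra; exists b; apply: Rab; right.
split=> [u [/RAB//|->]//|x y y'|x x' y].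
- move=> [Rxy|[xa yb]] [Rxy'|[xa' yb']].
  + exact: Rfun Rxy Rxy'.
  + by case: Ra; exists y; rewrite -xa'.
  + by case: Ra; exists y'; rewrite -xa.
  + by rewrite yb yb'.
- move=> [Rxy|[xa yb]] [Rxy'|[xa' yb']].
  + exact: Rinj Rxy Rxy'.
  + by case: Rb; exists x; rewrite -yb'.
  + by case: Rb; exists x'; rewrite -yb.
  + by rewrite xa xa'.
Qed.

(* Take a maximal infinite [X] with an injection from [X * X] to [X].  If [X]
   injected into its complement, the copy of [X] found there would have room for
   the missing pairs, so the complement injects into [X] instead. *)
Lemma infinite_pairing (T : Type) : infinite_set [set: T] ->
  exists f : T -> T -> T, forall x y x' y', f x y = f x' y' -> x = x' /\ y = y'.
Proof.
move=> Tinf.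
pose good (p : set T * (T -> T -> T)) := [/\ infinite_set p.1,
  forall x y, p.1 x -> p.1 y -> p.1 (p.2 x y) &
  forall x y x' y', p.1 x -> p.1 y -> p.1 x' -> p.1 y' ->
    p.2 x y = p.2 x' y' -> x = x' /\ y = y'].
(* Extension is only a preorder: functions paired with the same set may differ outside it. *)
pose R (p q : {p | good p}) := `[< (sval p).1 `<=` (sval q).1 /\
  forall x y, (sval p).1 x -> (sval p).1 y ->
    (sval q).2 x y = (sval p).2 x y >].
have [c cinj _] := infinite_set_seq Tinf.
(* Here [xget] inverts [c], which carries the pairing of [nat] over to the range of [c]. *)
have c0good : good (range c, fun x y => c (pickle (xget 0%N [set n | c n = x],
                                              xget 0%N [set n | c n = y]))).
  have cK n : xget 0%N [set m | c m = c n] = n.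
    by apply: cinj; apply: (@xgetPex _ 0%N [set m | c m = c n]); exists n.
  split=> /= [|_ _ [m _ <-] [n _ <-]|].
  - move=> /(finite_preimage (in2W cinj)); rewrite preimage_range.
    exact: infinite_nat.
  - by rewrite !cK; exists (pickle (m, n)).
  - move=> _ _ _ _ [m _ <-] [n _ <-] [m' _ <-] [n' _ <-].
    by rewrite !cK => /cinj/(pcan_inj pickleK)[-> ->].
have [| | |[[X f] Xgood] Xmax] := @ZL_preorder {p | good p}
   (exist _ _ c0good) R.
- by move=> p; apply/asboolP; split.
- move=> p q r /asboolP[pq epq] /asboolP[qr eqr]; apply/asboolP; split.
    exact: subset_trans pq qr.
  by move=> x y px py; rewrite eqr ?epq//; exact: pq.
- move=> C Ctot.
  have [[p0 Cp0]|C0] := pselect (C !=set0); last first.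
    by exists (exist _ _ c0good) => p Cp; case: C0; exists p.
  pose X := \bigcup_(p in C) (sval p).1.
  have common x y : X x -> X y -> exists2 p, C p & (sval p).1 x /\ (sval p).1 y.
    move=> [p Cp px] [q Cq qy].
    have [/asboolP[pq _]|/asboolP[qp _]] := Ctot _ _ Cp Cq.
      by exists q => //; split=> //; exact: pq.
    by exists p => //; split=> //; exact: qp.
  have /choice[f fE] (u : T * T) : exists z, forall p, C p -> (sval p).1 u.1 ->
      (sval p).1 u.2 -> z = (sval p).2 u.1 u.2.
    have [[p [Cp px py]]|np] := pselect (exists p, [/\ C p, (sval p).1 u.1 &
        (sval p).1 u.2]); last first.
      by exists (c 0%N) => p Cp px py; case: np; exists p.
    exists ((sval p).2 u.1 u.2) => q Cq qx qy.
    by have [/asboolP[_ ->]|/asboolP[_ ->]] := Ctot _ _ Cp Cq.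
  have Xgood : good (X, fun x y => f (x, y)).
    split=> /=.
    - have [p0inf _ _] := svalP p0; apply: sub_infinite_set p0inf.
      by move=> x p0x; exists p0.
    - move=> x y Xx Xy; have [p Cp [px py]] := common _ _ Xx Xy.
      rewrite (fE _ _ Cp)//=; exists p => //.
      by have [_ + _] := svalP p; exact.
    - move=> x y x' y' Xx Xy Xx' Xy'.
      have [p Cp [px py]] := common _ _ Xx Xy.
      have [q Cq [qx qy]] := common _ _ Xx' Xy'.
      rewrite (fE _ _ Cp)//= (fE _ _ Cq)//=.
      have [/asboolP[pq <-]|/asboolP[qp <-]] := Ctot _ _ Cp Cq => //.
        by have [_ _ +] := svalP q; apply=> //; exact: pq.
      by have [_ _ +] := svalP p; apply=> //; exact: qp.
  exists (exist _ _ Xgood) => p Cp; apply/asboolP; split=> /=.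
    by move=> x px; exists p.
  by move=> x y px py; exact: (fE (x, y) p).
have [/= Xinf Xf finj] := Xgood.
have [d dinj dX] := infinite_set_seq Xinf.
have d01 : d 0%N <> d 1%N by move=> /dinj.
(* [k] embeds two disjoint copies of [X] into [X], one for each bit *)
pose k b x := f x (d b).
have kX b x : X x -> X (k b x) by move=> Xx; exact: Xf.
have kinj b b' x x' : X x -> X x' -> k b x = k b' x' -> b = b' /\ x = x'.
  by move=> Xx Xx' /finj[]// -> /dinj ->.
have [[g gX ginj]|[g gX ginj]] := set_inj_total (~` X) X.
  (* The complement of [X] injects into [X], so [h] sends [X] and its complement to the two copies,
     and the pairing of [X] pulls back to [T]. *)
  pose h x := if pselect (X x) then k 0%N x else k 1%N (g x).
  have hX x : X (h x).
    by rewrite /h; case: pselect => Xx; apply: kX => //; exact: gX.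
  have hinj : injective h.
    move=> x y; rewrite /h; case: pselect => Xx; case: pselect => Xy //.
    - by move=> /kinj[].
    - by move=> /kinj[]//; exact: gX.
    - by move=> /kinj[]//; exact: gX.
    - by move=> /kinj[]; [exact: gX|exact: gX|]=> _; apply: ginj; exact/mem_set.
  exists (fun x y => f (h x) (h y)) => x y x' y' /finj.
  by move=> /(_ (hX _) (hX _) (hX _) (hX _))[/hinj -> /hinj ->].
have [r rE] : exists r : T -> T, forall x, X x -> r (g x) = x.
  have /choice[r rE] y : exists x, forall x', X x' -> g x' = y -> x = x'.
    have [[x [Xx <-]]|ny] := pselect (exists x, X x /\ g x = y).
      by exists x => x' Xx' /ginj -> //; exact/mem_set.
    by exists y => x Xx gxy; case: ny; exists x.
  by exists r => x Xx; exact: rE.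
pose Y := X `|` g @` X.
pose h x := if pselect (X x) then k 0%N x else k 1%N (r x).
have h0 x : X x -> h x = k 0%N x by rewrite /h; case: pselect.
have h1 x : X x -> h (g x) = k 1%N x.
  by move=> Xx; rewrite /h; case: pselect => [/(gX _ Xx)[]|?] /=; rewrite rE.
have hX x : Y x -> X (h x).
  by move=> [Xx|[y Xy <-]]; [rewrite h0|rewrite h1] => //; exact: kX.
have hinj x y : Y x -> Y y -> h x = h y -> x = y.
  move=> [Xx|[x' Xx' <-]] [Xy|[y' Xy' <-]].
  - by rewrite !h0// => /kinj[].
  - by rewrite h0// h1// => /kinj[].
  - by rewrite h1// h0// => /kinj[].
  - by rewrite !h1// => /kinj[]// _ ->.
(* The new pairs get values in the image of [g], outside of [X], so they never collide with the old
   ones. *)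
pose f' x y := if pselect (X x /\ X y) then f x y else g (f (h x) (h y)).
have Ygood : good (Y, f').
  split=> /=.
  - by apply: sub_infinite_set Xinf; left.
  - move=> x y Yx Yy; rewrite /f'; case: pselect => [[Xx Xy]|?] /=.
      by left; exact: Xf.
    by right; exists (f (h x) (h y)) => //; apply: Xf; exact: hX.
  - move=> x y x' y' Yx Yy Yx' Yy'; rewrite /f'.
    have fh u v : Y u -> Y v -> X (f (h u) (h v)).
      by move=> Yu Yv; apply: Xf; exact: hX.
    case: pselect => [[Xx Xy]|?]; case: pselect => [[Xx' Xy']|?] /=.
    + exact: finj.
    + by move=> e; case: (gX _ (fh _ _ Yx' Yy')); rewrite -e; exact: Xf.
    + by move=> e; case: (gX _ (fh _ _ Yx Yy)); rewrite e; exact: Xf.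
    + move/ginj; rewrite !inE => /(_ (fh _ _ Yx Yy) (fh _ _ Yx' Yy'))/finj.
      move=> /(_ (hX _ Yx) (hX _ Yy) (hX _ Yx') (hX _ Yy'))[].
      by move=> /hinj -> // /hinj ->.
have /asboolP[/= YX _] : R (exist _ (Y, f') Ygood) (exist _ (X, f) Xgood).
  apply: Xmax; apply/asboolP; split=> /= [x Xx|x y Xx Xy]; first by left.
  by rewrite /f'; case: pselect => // -[].
by case: (gX _ (dX 0%N)); apply: YX; right; exists (d 0%N).
Qed.

(** Folding the pairing separates lists of equal length, hence the length is coded as well. *)
Lemma seq_injection (T : Type) : infinite_set [set: T] ->
  exists f : seq T -> T, injective f.
Proof.
move=> Tinf; have [f finj] := infinite_pairing Tinf.
have [c cinj _] := infinite_set_seq Tinf.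
pose g := foldr f (c 0%N).
have ginj s t : size s = size t -> g s = g t -> s = t.
  elim: s t => [|x s IHs] [|y t]//= [st] /finj[-> /IHs ->//].
exists (fun s => f (c (size s)) (g s)) => s t /finj[/cinj]; exact: ginj.
Qed.

(** [D] is infinite because [T] is, so [D * D] injects into [D]; code [t] by an index [i] with
    [E i t] and a number that identifies [t] within [E i]. *)
Lemma bigcup_finite_injection (T K : Type) (D : set K) (E : K -> set T) :
    infinite_set [set: T] -> (forall i, D i -> finite_set (E i)) ->
    \bigcup_(i in D) E i = setT ->
  exists2 f : T -> K, forall t, D (f t) & injective f.
Proof.
move=> Tinf Efin DE.
have [Dfin|Dinf] := pselect (finite_set D).
  by case: Tinf; rewrite -DE; exact: bigcup_finite.
have [f finj] : exists f : D -> D -> D,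
    forall x y x' y', f x y = f x' y' -> x = x' /\ y = y'.
  by apply: infinite_pairing; rewrite (eq_finite_set (card_setT D)).
have [c cinj _] : exists2 c : nat -> D, injective c & forall n, [set: D] (c n).
  by apply: infinite_set_seq; rewrite (eq_finite_set (card_setT D)).
have /choice[i iE] t : exists i : D, E (val i) t.
  have [i Di Eit] : (\bigcup_(i in D) E i) t by rewrite DE.
  by exists (SigSub (mem_set Di)).
have /choice[e einj] (j : D) :
    exists e : T -> nat, {in E (val j) &, injective e}.
  by apply/countable_injP/finite_set_countable/Efin/set_mem/valP.
exists (fun t => val (f (i t) (c (e (i t) t)))) => [t|t u].
  exact/set_mem/valP.
move=> /val_inj/finj[itu /cinj]; rewrite -itu; apply: einj; rewrite inE //.
by rewrite itu.
Qed.

(** * Transfinite construction of independent translates *)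

Lemma small_well_order (K T : Type) (j : K -> T) : injective j ->
  exists R : K -> K -> Prop, [/\ well_founded R,
    forall x y, x <> y -> R x y \/ R y x &
    forall a (h : T -> K), (forall t, R (h t) a) -> ~ injective h].
Proof.
move=> jinj.
have [Q Qwo] := @wochoice.well_ordering_principle {classic K}.
have Qanti : {in predT &, antisymmetric Q}.
  exact: wochoice.wo_chain_antisymmetric (wochoice.withinW Qwo).
have Qmin (A : set K) : A !=set0 -> exists2 z, A z & forall y, A y -> Q z y.
  move=> [x Ax].
  have [|z [[Az Amin] _]] := Qwo [pred y : {classic K} | `[< A y >]].
    by exists x; exact/asboolP.
  by exists z => [|y Ay]; [exact/asboolP|apply: Amin; exact/asboolP].
pose lt x y := ~ Q y x.
have ltwf : well_founded lt.
  move=> x; apply: contrapT => nx.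
  have [z nz zmin] := Qmin [set y | ~ Acc lt y] (ex_intro _ x nx).
  by apply: nz; constructor => y yz; apply: contrapT => /zmin.
have lttot x y : x <> y -> lt x y \/ lt y x.
  move=> xy; apply: contrapT => /not_orP[/contrapT Qyx /contrapT Qxy].
  by apply: xy; apply: Qanti => //; rewrite Qxy.
(* If some initial segment receives an injection of [T], take the least such bound [a]. Then
   [h \o j] embeds [K] below [a], and in the order pulled back along it no initial segment is large,
   by minimality. *)
pose large := [set a | exists2 h : T -> K, forall t, lt (h t) a & injective h].
have [large0|nlarge] := pselect (large !=set0); last first.
  by exists lt; split=> // a h hlt hinj; apply: nlarge; exists a, h.
have [a [h hlt hinj] amin] := Qmin _ large0.
exists (fun x y => lt (h (j x)) (h (j y))); split.
- exact: wf_inverse_image.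
- by move=> x y xy; apply: lttot => /hinj/jinj.
- move=> b g glt ginj; apply: (hlt (j b)); apply: amin.
  by exists (h \o j \o g) => //; do 2! apply: inj_comp.
Qed.

(* The index set [K] is well-ordered with initial segments too small to inject
   [G], so the finitely many products excluded by each earlier index do not
   exhaust [G] and the [x i] can be picked by transfinite recursion. *)
Lemma disjoint_translates (G : groupType) (K : Type) (j : K -> G)
    (F : K -> seq G) : infinite_set [set: G] -> injective j ->
  exists x : K -> G, forall i k g h, g \in F i -> h \in F k ->
    (g * x i = h * x k)%g -> i = k.
Proof.
move=> Ginf /small_well_order[R [Rwf Rtot Rsmall]].
pose step i (x : forall k, R k i -> G) := xget 1%g
  [set y | forall k (ki : R k i) g h, g \in F i -> h \in F k ->
     (g * y <> h * x k ki)%g].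
pose x := Fix Rwf (fun=> G) step.
have xE i : x i = step i (fun k _ => x k).
  apply: (Fix_eq Rwf (fun=> G) step) => k u v uv.
  congr step; apply/functional_extensionality_dep => l.
  by apply/funext => lk; exact: uv.
have xP i k g h : R k i -> g \in F i -> h \in F k -> (g * x i <> h * x k)%g.
  move=> ki gi hk; rewrite xE /step; case: xgetP => [y -> yP|nex].
    exact: yP.
  have [f fR finj] : exists2 f : G -> K, forall t, R (f t) i & injective f.
    apply: (@bigcup_finite_injection _ _ [set k | R k i]
      (fun k => [set (u^-1 * (v * x k))%g | u in [set` F i]
                                          & v in [set` F k]])) => //.
      by move=> l _; apply: finite_image2.
    apply/seteqP; split=> // y _; apply: contrapT => ny; apply: (nex y) => /=.
    move=> l li u v ui vl e; apply: ny; exists l => //.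
    by exists u => //; exists v => //; rewrite -e mulKg.
  by case: (Rsmall _ _ fR finj).
exists x => i k g h gi hk e; apply: contrapT => /Rtot[ik|ki].
  exact: xP ik hk gi (esym e).
exact: xP ki gi hk e.
Qed.

(** An index [u] is a finite set of translates with the part of it where membership is wanted. The
    sets of products [g * x u] with [g] in [u.1] are disjoint for distinct [u], so each pattern is
    realized without interference. *)
Lemma independent_translates (G : groupType) : infinite_set [set: G] ->
  exists A : set G, forall (F : seq G) (a : set G),
    exists x, forall g, g \in F -> A (g * x)%g <-> a g.
Proof.
move=> Ginf; have [c cinj] := seq_injection Ginf.
have [f finj] := infinite_pairing Ginf.
have jinj : injective (fun u : seq G * seq G => f (c u.1) (c u.2)).
  by move=> [s t] [s' t'] /finj[/cinj/= -> /cinj/= ->].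
have [x xP] := disjoint_translates fst Ginf jinj.
exists [set y | exists u g, [/\ g \in u.1, g \in u.2 & y = (g * x u)%g]] => F a.
exists (x (F, [seq g <- F | `[< a g >]])) => g gF; split=> [|ag]; last first.
  exists (F, [seq g <- F | `[< a g >]]), g; split=> //=.
  by rewrite mem_filter gF andbT; exact/asboolP.
move=> /= [u [h [hu1 hu2 e]]].
have ue := xP (F, _) u g h gF hu1 e; move: e hu2; rewrite -ue => /mulIg <- /=.
by rewrite mem_filter => /andP[/asboolP].
Qed.

(** * Baire category in the Cantor cube *)

Section cylinders.
Variable T : eqType.
Implicit Types (F : seq T) (a y z : set T) (V N M : set (set T)).

(** For fixed [F] and [a], these [y] form a basic clopen set of the product topology on [2^T]. *)
Definition agree F y a := forall g, g \in F -> (y g <-> a g).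

Lemma agree_refl F y : agree F y y. Proof. by []. Qed.

Lemma agree_trans F y a z : agree F z y -> agree F y a -> agree F z a.
Proof. by move=> zy ya g gF; exact: iff_trans (zy g gF) (ya g gF). Qed.

Lemma agree_sub F F' y a : {subset F <= F'} -> agree F' y a -> agree F y a.
Proof. by move=> FF' ya g /FF'/ya. Qed.

Lemma agree_catl F F' y a : agree (F ++ F') y a -> agree F y a.
Proof. by apply: agree_sub => g gF; rewrite mem_cat gF. Qed.

Lemma agree_catr F F' y a : agree (F ++ F') y a -> agree F' y a.
Proof. by apply: agree_sub => g gF; rewrite mem_cat gF orbT. Qed.

Definition cylinder_open V :=
  forall y, V y -> exists F, forall z, agree F z y -> V z.

Definition nowhere_dense N := forall F a, exists F' a',
  agree F a' a /\ forall y, agree (F ++ F') y a' -> ~ N y.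

Definition meager M := exists2 N : nat -> set (set T),
  forall n, nowhere_dense (N n) & M `<=` \bigcup_n N n.

Lemma nowhere_dense0 : nowhere_dense set0.
Proof. by move=> F a; exists [::], a; split=> // y _ []. Qed.

Lemma nowhere_dense_meager N : nowhere_dense N -> meager N.
Proof. by move=> Nnd; exists (fun=> N) => // y Ny; exists 0%N. Qed.

Lemma meager_bigcup (M : nat -> set (set T)) :
  (forall n, meager (M n)) -> meager (\bigcup_n M n).
Proof.
move=> /(_ _)/cid2-/all_sig[N NP].
pose D (u : option (nat * nat)) := if u is Some (m, n) then N m n else set0.
exists (fun k => D (unpickle k)) => [k|y [m _ /(NP m).2[n _ Ny]]].
  by case: unpickle => [[m n]|]; [exact: (NP m).1|exact: nowhere_dense0].
by exists (pickle (m, n)) => //; rewrite pickleK.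
Qed.

Lemma meagerU M M' : meager M -> meager M' -> meager (M `|` M').
Proof.
move=> Mm Mm'; rewrite -bigcup2E; apply: meager_bigcup => -[|[|n]] //=.
exact/nowhere_dense_meager/nowhere_dense0.
Qed.

(** Baire category theorem for the cube: nested cylinders miss one [N n] after another and have a
    common point, as each stage keeps the earlier coordinates. *)
Lemma meager_avoid M F a : meager M -> exists2 y, agree F y a & ~ M y.
Proof.
move=> [N Nnd MN].
have /choice[step stepP] (u : nat * (seq T * set T)) :
    exists v : seq T * set T, [/\ {subset u.2.1 <= v.1}, agree u.2.1 v.2 u.2.2 &
      forall y, agree v.1 y v.2 -> ~ N u.1 y].
  have [F' [a' [a'a Na']]] := Nnd u.1 u.2.1 u.2.2.
  by exists (u.2.1 ++ F', a'); split=> //= g gF; rewrite mem_cat gF.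
pose c := fix c n := if n is n'.+1 then step (n', c n') else (F, a).
have cP m n : m <= n ->
    {subset (c m).1 <= (c n).1} /\ agree (c m).1 (c n).2 (c m).2.
  elim: n => [|n IHn].
    by rewrite leqn0 => /eqP ->; split; [move=> g|exact: agree_refl].
  rewrite leq_eqVlt => /predU1P[->|/IHn[sub agr]].
    by split; [move=> g|exact: agree_refl].
  have [sub' agr' _] := stepP (n, c n); split=> [g /sub/sub' //|].
  exact: agree_trans (agree_sub sub agr') agr.
(* Coordinates that no stage fixes are left out of [y]. *)
pose y := [set g | exists2 n, g \in (c n).1 & (c n).2 g].
have yP n : agree (c n).1 y (c n).2.
  move=> g gn; split=> [[m gm cmg]|cng]; last by exists n.
  have [/cP[_ agr]|/ltnW/cP[_ agr]] := leqP m n; first exact/agr.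
  exact/agr.
exists y; first exact: (yP 0%N).
move=> /MN[n _]; have [_ _ ] := stepP (n, c n); apply; exact: (yP n.+1).
Qed.

(* [off F y] flips the membership in [y] of every point outside of [F]. *)
Definition off F y := [set g | if g \in F then y g else ~ y g].

Lemma offK F : involutive (off F).
Proof.
move=> y; apply/funext => g; rewrite /off /=.
by case: ifP => gF; rewrite /= gF ?notK.
Qed.

Lemma agree_off F K y a : agree K y a -> agree K (off F y) (off F a).
Proof. by move=> ya g /ya; rewrite /off /=; case: ifP => // _ ->. Qed.

(** [off F] is an involution that maps cylinders to cylinders, hence a homeomorphism. *)
Lemma meager_off F M : meager M -> meager (off F @^-1` M).
Proof.
move=> [N Nnd MN]; exists (fun n => off F @^-1` N n) => [n K a|y /MN //].
have [K' [a' [a'a NK']]] := Nnd n K (off F a).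
exists K', (off F a'); split; first by rewrite -[a](offK F); exact: agree_off.
by move=> y ya'; apply: NK'; rewrite -[a'](offK F); exact: agree_off.
Qed.

End cylinders.

(** * Nonprincipal ultrafilters as subsets of the cube *)

Lemma nonprincipal_cofinite (T : choiceType) (p : beta T) (F : seq T) :
  ~ range (@beta_principal T) p -> p [set g | g \notin F].
Proof.
move=> np; elim: F => [|x F pF]; first by apply: filterS (@filterT _ p _) => g.
have px : p [set~ x].
  apply/betaC => px; apply: np; exists x => //; apply: beta_ext => A.
  by move=> /principal_filterP Ax; apply: filterS px => _ ->.
by apply: filterS2 pF px => g /= gF /eqP gx; rewrite inE negb_or gx.
Qed.

(* A nonprincipal ultrafilter lacks the Baire property: [y] and [off F y] meet
   within [F], so no ultrafilter contains both. *)
Lemma ultrafilter_not_almost_open (T : choiceType) (p : beta T)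
    (V M : set (set T)) : ~ range (@beta_principal T) p ->
  cylinder_open V -> meager M -> ~ (forall y, ~ M y -> (p y <-> V y)).
Proof.
move=> np Vo Mm pV.
have [F [a aP]] : exists F a, (forall z, agree F z a -> V z) \/ V = set0.
  have [[a /Vo[F Fa]]|V0] := pselect (V !=set0); first by exists F, a; left.
  exists [::], set0; right; apply/seteqP; split=> // y Vy.
  by case: V0; exists y.
have [y ya /not_orP[My Moy]] := meager_avoid F a (meagerU Mm (meager_off F Mm)).
case: aP => [FV|V0].
  have py : p y by apply/pV/FV.
  have poy : p (off F y).
    apply/pV/FV => //; apply: agree_trans ya => g gF.
    by rewrite /off /= gF.
  have [g [/= gF [yg]]] :=
    filter_ex (filterI (nonprincipal_cofinite F np) (filterI py poy)).
  by rewrite /off /= (negbTE gF).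
(* If [V] is empty, the complements of [y] and [off F y] are both in [p], and they too are disjoint
   outside of [F]. *)
have npy : ~ p y by move=> /(pV _ My); rewrite V0.
have npoy : ~ p (off F y) by move=> /(pV _ Moy); rewrite V0.
have /betaC pcy := npy; have /betaC pcoy := npoy.
have [g [/= gF [yg]]] :=
  filter_ex (filterI (nonprincipal_cofinite F np) (filterI pcy pcoy)).
by apply; rewrite /off /= (negbTE gF).
Qed.

(** * An irreducible surjection onto the cube and almost open sets *)

Section maximal_filter.
Variables (X : Type) (T : eqType) (e : X -> set T).
Hypothesis edense : forall F a, exists x, agree F (e x) a.

Definition somewhere (B : set X) F a := exists2 x, B x & agree F (e x) a.

(* The ultrafilters containing [L] form a minimal closed subset of [beta X] that
   is mapped onto the cube. *)
Lemma maximal_dense_filter : exists L : set_system X,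
  [/\ Filter L, forall B, L B -> forall F a, somewhere B F a &
      forall N, (forall C, L C -> forall F a, somewhere (C `&` N) F a) -> L N].
Proof.
pose dense (L : set_system X) :=
  Filter L /\ forall B, L B -> forall F a, somewhere B F a.
have [C CP Ctot|L [[L0|[Lf Ld]] Lmax]] :=
    @Zorn_bigcup _ [set L : set_system X | L = set0 \/ dense L].
- have [[S0 [CS0 S0d]]|nd] := pselect (exists S, C S /\ dense S); last first.
    left; apply/seteqP; split=> // B [S CS].
    by have [->|Sd] := CP _ CS => //; case: nd; exists S.
  have CSd S B : C S -> S B -> dense S.
    by move=> CS SB; have [S0'|//] := CP _ CS; rewrite S0' in SB.
  right; split; last by move=> B [S CS SB]; have [_ +] := CSd _ _ CS SB; apply.
  split; first by exists S0 => //; case: S0d => ? _; exact: filterT.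
    move=> A B [S CS SA] [S' CS' SB].
    have [[Sf _] [S'f _]] := (CSd _ _ CS SA, CSd _ _ CS' SB).
    have [SS'|S'S] := Ctot _ _ CS CS'.
      by exists S' => //; apply: filterI => //; exact: SS'.
    by exists S => //; apply: filterI => //; exact: S'S.
  move=> A B AB [S CS SA]; have [Sf _] := CSd _ _ CS SA.
  by exists S => //; exact: filterS SA.
- exfalso; apply: (Lmax [set setT]).
    by rewrite L0; split=> // /(_ setT); apply.
  right; split; first split=> //.
  + by move=> A B -> ->; rewrite setIT.
  + by move=> A B AB AT; apply/seteqP; split=> // x _; apply: AB; rewrite AT.
  + by move=> B -> F a; have [x xa] := edense F a; exists x.
- exists L; split=> // N LN.
  (* The filter generated by [L] and [N]. *)
  pose L' := [set B | exists2 C, L C & C `&` N `<=` B].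
  have LL' : L `<=` L' by move=> B LB; exists B => // x [].
  have L'd : dense L'.
    split; last first.
      move=> B [C LC CB] F a; have [x CNx xa] := LN C LC F a.
      by exists x => //; exact: CB.
    split; first by exists setT => //; exact: filterT.
      move=> A B [C LC CA] [D LD DB]; exists (C `&` D); first exact: filterI.
      by move=> x [[Cx Dx] Nx]; split; [exact: CA|exact: DB].
    by move=> A B AB [C LC CA]; exists C => // x /CA/AB.
  have [L'L|nL'L] := pselect (L' `<=` L).
    by apply: L'L; exists setT; [exact: filterT|move=> x []].
  by case: (Lmax L' (conj LL' nL'L)); right.
Qed.

(** The continuous extension of [e] to [beta X]. *)
Definition trace (q : beta X) : set T := [set g | q [set x | e x g]].

(** This gives the continuity of [trace]: [q] decides each coordinate, and finitely many decisions
    can be intersected. *)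
Lemma agree_trace q F y : agree F (trace q) y <-> q [set x | agree F (e x) y].
Proof.
split.
  elim: F => [|g F IHF] qy; first by apply: filterS (@filterT _ q _) => x _ g.
  have /IHF qF : agree F (trace q) y.
    by move=> h hF; apply: qy; rewrite inE hF orbT.
  have qg : q [set x | e x g <-> y g].
    have [+ +] := qy g (mem_head _ _); have [yg|nyg] := pselect (y g).
      by move=> _ /(_ yg); apply: filterS => x.
    move=> /contra_not/(_ nyg)/betaC qn _; apply: filterS qn => x nx.
    by split.
  by apply: filterS2 qg qF => x xg xF h; rewrite inE => /predU1P[->|/xF].
move=> qy g gF; split=> [qg|yg].
  by have [x [xF xg]] := filter_ex (filterI qy qg); apply/(xF g gF).
by apply: filterS qy => x xF; apply/(xF g gF).
Qed.

Variable L : set_system X.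
Hypothesis Lfilter : Filter L.
Hypothesis Ldense : forall B, L B -> forall F a, somewhere B F a.
Hypothesis Lmax :
  forall N, (forall C, L C -> forall F a, somewhere (C `&` N) F a) -> L N.

Lemma trace_surj y : exists2 q : beta X, L `<=` q & trace q = y.
Proof.
(* The filter generated by [L] and the preimages under [e] of the cylinders around [y]; it is proper
   because members of [L] have dense image. *)
pose S := [set B | exists F, L [set x | agree F (e x) y -> B x]].
have SP : ProperFilter S.
  apply: Build_ProperFilter_ex.
    by move=> B [F /Ldense/(_ F y)[x Bx /Bx]]; exists x.
  split.
  - by exists [::]; apply: filterS filterT.
  - move=> A B [F FA] [F' FB]; exists (F ++ F').
    apply: filterS2 FA FB => x Ax Bx xy.
    by split; [exact: Ax (agree_catl xy)|exact: Bx (agree_catr xy)].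
  - by move=> A B AB [F FA]; exists F; apply: filterS FA => x Ax /Ax/AB.
have [q [qu Sq]] := ultraFilterLemma SP.
exists (Beta q qu) => [B LB|].
  by apply: Sq; exists [::]; apply: filterS LB => x Bx _.
apply/funext => g; apply/propext.
suff /agree_trace : Beta q qu [set x | agree [:: g] (e x) y].
  by apply; exact: mem_head.
by apply: Sq; exists [:: g]; apply: filterS filterT => x _ xy.
Qed.

(* The trace map restricted to the closed set of ultrafilters above [L] is an
   irreducible surjection, which is what makes this class contain open sets. *)
Definition almost_open (B : set (beta X)) := exists V M,
  [/\ cylinder_open V, meager M &
      forall q : beta X, L `<=` q -> ~ M (trace q) -> (B q <-> V (trace q))].

Lemma open_almost_open (U : set (beta X)) : open U -> almost_open U.
Proof.
move=> Uo.
(* Over some cylinder around such a [y], all ultrafilters above [L] contain one [B] and so lie in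
   [U]. *)
pose V := [set y | exists F B, [/\ [set q : beta X | q B] `<=` U &
  L [set x | agree F (e x) y -> B x]]].
have VU (q : beta X) : L `<=` q -> V (trace q) -> U q.
  move=> Lq [F [B [BU /Lq qB]]]; apply: BU => /=.
  have qF : q [set x | agree F (e x) (trace q)] by exact/agree_trace.
  by apply: filterS2 qB qF => x; apply.
exists V, [set y | ~ V y /\ exists2 q : beta X, L `<=` q & trace q = y /\ U q].
split.
- move=> y [F [B [BU LB]]]; exists F => z zy; exists F, B; split=> //.
  by apply: filterS LB => x xB xz; apply: xB; exact: agree_trans xz zy.
- apply: nowhere_dense_meager => F a.
  have [[q [Lq qa Uq]]|nq] := pselect (exists q : beta X,
      [/\ L `<=` q, agree F (trace q) a & U q]); last first.
    exists [::], a; split=> // y; rewrite cats0 => ya [_ [q Lq [qy Uq]]].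
    by apply: nq; exists q; rewrite qy.
  have /nbhs_betaP[B qB BU] : nbhs q U by exact: open_nbhs_nbhs.
  have qF : q [set x | agree F (e x) a] by exact/agree_trace.
  pose N := [set x | ~ (B x /\ agree F (e x) a)].
  have nLN : ~ L N.
    move=> /Lq qN.
    by have [x [Nx BFx]] := filter_ex (filterI qN (filterI qB qF)); apply: Nx.
  (* Maximality of [L] enters here: as [N] is not in [L], some [C] in [L] avoids [N] over a whole
     cylinder. *)
  have [C [LC [F' [a' CN]]]] :
      exists C, L C /\ exists F' a', ~ somewhere (C `&` N) F' a'.
    apply: contrapT => nC; apply/nLN/Lmax => C LC F' a'.
    by apply: contrapT => nC'; apply: nC; exists C; split=> //; exists F', a'.
  have CB x : C x -> agree F' (e x) a' -> B x /\ agree F (e x) a.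
    by move=> Cx xa'; apply: contrapT => Nx; apply: CN; exists x.
  (* The point [e x] lies in both cylinders, so agreement with it on [F ++ F'] refines [F], [a] and
     forces membership in [V]. *)
  have [x Cx xa'] := Ldense LC F' a'; have [_ xa] := CB x Cx xa'.
  exists F', (e x); split=> // y yx [nVy _]; apply: nVy.
  exists F', B; split=> //; apply: filterS LC => z Cz zy.
  apply: (CB z Cz _).1.
  exact: agree_trans (agree_trans zy (agree_catr yx)) xa'.
- move=> q Lq nM; split; last exact: VU.
  by move=> Uq; apply: contrapT => nV; apply: nM; split=> //; exists q.
Qed.

(** [W] is the interior of the complement of [V], and what remains is the boundary of an open set,
    which is nowhere dense. *)
Lemma almost_openC (B : set (beta X)) : almost_open B -> almost_open (~` B).
Proof.
move=> [V [M [Vo Mm BV]]].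
pose W := [set y | exists F, forall z, agree F z y -> ~ V z].
exists W, (M `|` [set y | ~ V y /\ ~ W y]); split.
- move=> y [F yF]; exists F => z zy; exists F => w wz; apply: yF.
  exact: agree_trans wz zy.
- apply: meagerU => //; apply: nowhere_dense_meager => F a.
  have [[y ya Vy]|nV] := pselect (exists2 y, agree F y a & V y).
    have [F' yF'] := Vo _ Vy; exists F', y; split=> // z zy [nVz _].
    exact: nVz (yF' _ (agree_catr zy)).
  exists [::], a; split=> // y; rewrite cats0 => ya [_]; apply; exists F.
  by move=> z zy Vz; apply: nV; exists z => //; exact: agree_trans zy ya.
- move=> q Lq /not_orP[nM nVW]; have BVq := BV q Lq nM; split=> [nB|].
    by apply: contrapT => nW; apply: nVW; split=> // /BVq.
  by move=> [F WF] /BVq; apply: WF.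
Qed.

Lemma almost_open_bigcup (B : nat -> set (beta X)) :
  (forall n, almost_open (B n)) -> almost_open (\bigcup_n B n).
Proof.
move=> /choice[V /choice[M VM]].
exists (\bigcup_n V n), (\bigcup_n M n); split.
- move=> y [n _ Vy]; have [Vo _ _] := VM n; have [F yF] := Vo _ Vy.
  by exists F => z /yF; exists n.
- by apply: meager_bigcup => n; have [] := VM n.
- move=> q Lq nM.
  have BV n : B n q <-> V n (trace q).
    by have [_ _ +] := VM n; apply=> // Mq; apply: nM; exists n.
  by split=> -[n _ /BV]; exists n.
Qed.

Lemma sigma_algebra_almost_open : sigma_algebra setT almost_open.
Proof.
split=> [|B|]; last exact: almost_open_bigcup.
  exact/open_almost_open/open0.
by rewrite setTD; exact: almost_openC.
Qed.

End maximal_filter.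

(** * Left multiplication and the Baire property *)

Theorem theorem2p1 (G : groupType) (Ginf : infinite_set [set: G])
    (p : beta G) (hp : ~ range (@beta_principal G) p) :
  ~ measurable_fun [set: borel (beta G)]
      ((fun q : beta G => (p * q)%g) : borel (beta G) -> borel (beta G)).
Proof.
move=> mp; have [A Aind] := independent_translates Ginf.
(* Independence says that [e] has dense image, and [p * q] contains [A] exactly when the trace of
   [q] is a member of [p]. *)
pose e (x : G) := [set g | A (g * x)%g].
have [L [Lf Ld Lmax]] := @maximal_dense_filter G G e Aind.
have : almost_open e L [set q : beta G | (p * q)%g A].
  have := mp measurableT [set r : borel (beta G) | beta_sets r A].
  rewrite setTI => /(_ (sub_gen_smallest (@open_beta_base G A))).
  apply: smallest_sub.
    exact: sigma_algebra_almost_open.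
  by move=> U; apply: open_almost_open.
move=> [V [M [Vo Mm pV]]].
apply: (ultrafilter_not_almost_open hp Vo Mm) => y nMy.
(* Lifting [y] to some [q] above [L] turns almost openness of the preimage into the Baire property
   of [p]. *)
have [q Lq qy] := @trace_surj _ _ e _ Lf Ld y.
rewrite -qy in nMy *; rewrite -(pV q Lq nMy).
by rewrite /mkset [X in _ <-> X]beta_mulE.
Qed.
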